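(* Let $\mathbf K_*$ be a class of strongly rigid right-angled Coxeter groups such that $\Gamma_A$ is triangle-free for every $A\in\mathbf K_*$. Suppose that whenever $A,B\in\mathbf K_*$, $A\preccurlyeq B$, and $T$ is a Coxeter basis of $B$ such that $S=T\cap A$ is a Coxeter basis of $A$, the set $S$ contains four vertices $s_0,s_1,s_2,s_3$ with $s_0Es_1$, $s_1Es_2$, $s_2Es_3$, $s_0$ not adjacent to $s_2$ and $s_1$ not adjacent to $s_3$. Then: (i) (Smoothness) for every increasing continuous $\preccurlyeq$-chain $(A_i)_{i<\delta}$ in $\mathbf K_*$ and every $B\in\mathbf K_*$ with $A_i\preccurlyeq B$ for all $i<\delta$, we have $\bigcup_{i<\delta}A_i\preccurlyeq B$; (ii) (Finite character) whenever $A,B\in\mathbf K_*$, $A$ is a subgroup of $B$, and for every finite $X\subseteq A$ there is a $\preccurlyeq$-embedding $f_X:A\to B$ with $f_X\restriction X=\mathrm{id}_X$, we have $A\preccurlyeq B$.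
   Context: A right-angled Coxeter group is a group $W$ with a presentation whose generating set $S$ (a Coxeter basis, possibly infinite) satisfies only relations $s^2=e$ and $(ss')^2=e$ for some pairs of distinct $s,s'\in S$; the Coxeter graph $\Gamma_W$ (with respect to a basis) has vertex set the basis, distinct vertices adjacent ($E$) iff they commute. $W$ is strongly rigid if for any two Coxeter bases $S,S'$ there is $g\in W$ with $gSg^{-1}=S'$. $A\preccurlyeq B$ iff $A$ is a subgroup of $B$ and some Coxeter basis $S$ of $B$ has $A\cap S$ a Coxeter basis of $A$. A $\preccurlyeq$-embedding is an injective homomorphism $f:A\to B$ with $f(A)\preccurlyeq B$. A chain $(A_i)_{i<\delta}$ is increasing if $A_i\preccurlyeq A_j$ for $i<j$, continuous if $A_j=\bigcup_{i<j}A_i$ at limits. *)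

(* Defs.v *)
From mathcomp Require Import all_boot all_order.
From mathcomp Require Import boolp classical_sets functions cardinality.

Set Implicit Arguments.
Unset Strict Implicit.
Unset Printing Implicit Defensive.

Local Open Scope classical_set_scope.
Local Open Scope group_scope.

(* Group words over an alphabet X: the letter (false, x) stands for x and
   (true, x) for its formal inverse. *)
Definition word (X : Type) := seq (bool * X).

(* Equality of words in the group < X | R >. *)
Inductive pres_eq (X : Type) (R : set (word X)) : word X -> word X -> Prop :=
| pres_refl w : pres_eq R w w
| pres_sym u v : pres_eq R u v -> pres_eq R v u
| pres_trans u v w : pres_eq R u v -> pres_eq R v w -> pres_eq R u w
| pres_cancel u v b x :
    pres_eq R (u ++ [:: (b, x); (~~ b, x)] ++ v) (u ++ v)
| pres_relator u v r : R r -> pres_eq R (u ++ r ++ v) (u ++ v).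

Definition eval_word (G : groupType) (X : Type) (g : X -> G) (w : word X) : G :=
  \prod_(l <- w) (if l.1 then (g l.2)^-1 else g l.2).

(* g induces an isomorphism from < X | R > onto the subgroup A of G. *)
Definition presents (G : groupType) (A : set G) (X : Type) (g : X -> G)
    (R : set (word X)) : Prop :=
  range (eval_word g) = A /\
  forall w, eval_word g w = 1 <-> pres_eq R w [::].

Inductive ra_relator (X : Type) (E : X -> X -> Prop) : set (word X) :=
| ra_square x : ra_relator E [:: (false, x); (false, x)]
| ra_commute x y : x <> y -> E x y ->
    ra_relator E [:: (false, x); (false, y); (false, x); (false, y)].

(* Groups are handled as subgroups A of an ambient group G (a group that is a
   type on its own is the case A = setT), so that inclusions, intersections and
   unions of groups are the set-theoretic ones. *)
Definition is_subgroup (G : groupType) (A B : set G) : Prop :=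
  [/\ group_closed (mem A), group_closed (mem B) & A `<=` B].

Definition coxeter_basis (G : groupType) (A S : set G) : Prop :=
  exists E : S -> S -> Prop, presents A (fun s : S => val s) (ra_relator E).

Definition ra_coxeter_group (G : groupType) (A : set G) : Prop :=
  group_closed (mem A) /\ exists S : set G, coxeter_basis A S.

Definition cox_adj (G : groupType) (s t : G) : Prop := s <> t /\ commute s t.

Definition triangle_free (G : groupType) (S : set G) : Prop :=
  forall r s t, S r -> S s -> S t ->
    ~ [/\ cox_adj r s, cox_adj s t & cox_adj r t].

Definition strongly_rigid (G : groupType) (A : set G) : Prop :=
  forall S S' : set G, coxeter_basis A S -> coxeter_basis A S' ->
    exists2 g, A g & [set g * s * g^-1 | s in S] = S'.

Definition prec (G : groupType) (A B : set G) : Prop :=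
  is_subgroup A B /\
  exists S : set G, coxeter_basis B S /\ coxeter_basis A (A `&` S).

(* Only the values of f on A matter. *)
Definition prec_embedding (G H : groupType) (A : set G) (B : set H)
    (f : G -> H) : Prop :=
  [/\ {in A &, {morph f : x y / x * y}}, {in A &, injective f}
    & prec (f @` A) B].

(* No invariance under isomorphism is imposed on a class. *)
Definition group_class := forall G : groupType, set G -> Prop.

Definition has_four_path (G : groupType) (S : set G) : Prop :=
  exists s0 s1 s2 s3 : G,
    [/\ [/\ S s0, S s1, S s2 & S s3], uniq [:: s0; s1; s2; s3],
        [/\ cox_adj s0 s1, cox_adj s1 s2 & cox_adj s2 s3],
        ~ cox_adj s0 s2 & ~ cox_adj s1 s3].

Definition is_limit (d : Order.disp_t) (I : orderType d) (j : I) : Prop :=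
  (exists i : I, (i < j)%O) /\
  forall i : I, (i < j)%O -> exists k : I, (i < k)%O /\ (k < j)%O.

(* A nonzero ordinal delta is given as a nonempty well-ordered type I. *)
Definition nonzero_ordinal (d : Order.disp_t) (I : orderType d) : Prop :=
  inhabited I /\ well_founded (fun i j : I => (i < j)%O).

Definition increasing_chain (d : Order.disp_t) (I : orderType d)
    (G : groupType) (A : I -> set G) : Prop :=
  forall i j : I, (i < j)%O -> prec (A i) (A j).

Definition continuous_chain (d : Order.disp_t) (I : orderType d)
    (G : groupType) (A : I -> set G) : Prop :=
  forall j : I, is_limit j -> A j = \bigcup_(i in [set i : I | (i < j)%O]) A i.

(* Main.v *)
Require Import Defs.
From mathcomp Require Import all_boot all_order.
From mathcomp Require Import boolp classical_sets functions cardinality.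

(* If A is strongly rigid and A embeds in B along prec, then every basis of A
   maps into some basis of B.  A basis T of B is unique once it contains a given
   induced four-path P: another one is b T b^-1, and since conjugate generators
   are equal, b centralizes P.  The centralizer of a generator s is the special
   subgroup on its star, and in a triangle-free graph the stars of the vertices
   of P have no common vertex, so b = 1.  All bases extending the bases of the
   groups involved therefore coincide.

   The centralizer of s is computed without normal forms: letting c(w) be the
   parity of the number of letters s of w that are followed by a suffix in the
   star subgroup of s, c is a function of the group element, and comparing
   c(b s) with c(s b) decides whether b is in the star subgroup. *)

Set Implicit Arguments.
Unset Strict Implicit.
Unset Printing Implicit Defensive.

Import Order.TTheory.

Local Open Scope classical_set_scope.
Local Open Scope group_scope.

(** * Words and presentations *)

Lemma eval_nil (G : groupType) (X : Type) (g : X -> G) : eval_word g [::] = 1.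
Proof. by rewrite /eval_word big_nil. Qed.

Lemma eval_cons (G : groupType) (X : Type) (g : X -> G) l w :
  eval_word g (l :: w) = (if l.1 then (g l.2)^-1 else g l.2) * eval_word g w.
Proof. by rewrite /eval_word big_cons. Qed.

Lemma eval_cat (G : groupType) (X : Type) (g : X -> G) u v :
  eval_word g (u ++ v) = eval_word g u * eval_word g v.
Proof. by rewrite /eval_word big_cat. Qed.

Lemma eval_map (G : groupType) (X Y : Type) (g : X -> G) (h : Y -> X) w :
  eval_word g [seq (l.1, h l.2) | l <- w] = eval_word (g \o h) w.
Proof. by rewrite /eval_word big_map. Qed.

Definition inv_word (X : Type) (w : word X) : word X :=
  rev [seq (~~ l.1, l.2) | l <- w].

Lemma inv_word_cons (X : Type) (l : bool * X) w :
  inv_word (l :: w) = inv_word w ++ [:: (~~ l.1, l.2)].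
Proof. by rewrite /inv_word map_cons rev_cons cats1. Qed.

Lemma eval_inv_word (G : groupType) (X : Type) (g : X -> G) w :
  eval_word g (inv_word w) = (eval_word g w)^-1.
Proof.
elim: w => [|l w IH]; first by rewrite eval_nil invg1.
rewrite inv_word_cons eval_cat IH !eval_cons eval_nil mulg1 invgM /=.
by case: l.1; rewrite ?invgK.
Qed.

Lemma pres_eq_cat (X : Type) (R : set (word X)) a c u v :
  pres_eq R u v -> pres_eq R (a ++ u ++ c) (a ++ v ++ c).
Proof.
elim=> {u v} [w|u v _ IH|u v w _ IHu _ IHv|u v b x|u v r Rr].
- exact: pres_refl.
- exact: pres_sym.
- exact: pres_trans IHu IHv.
- by have := pres_cancel R (a ++ u) (v ++ c) b x; rewrite -!catA.
- by have := pres_relator (a ++ u) (v ++ c) Rr; rewrite -!catA.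
Qed.

Lemma pres_eq_inv_word (X : Type) (R : set (word X)) w :
  pres_eq R (inv_word w ++ w) [::].
Proof.
elim: w => [|l w IH]; first exact: pres_refl.
apply: pres_trans IH; rewrite inv_word_cons -catA.
by case: l => b x; have := pres_cancel R (inv_word w) w (~~ b) x; rewrite negbK.
Qed.

Lemma presents_eval (G : groupType) (A : set G) (X : Type) (g : X -> G) R u v :
  presents A g R -> eval_word g u = eval_word g v <-> pres_eq R u v.
Proof.
move=> [_ gR]; split=> [euv|].
  have /gR e1 : eval_word g (u ++ inv_word v) = 1.
    by rewrite eval_cat eval_inv_word euv mulgV.
  have := pres_eq_cat [::] v e1; have := pres_eq_cat u [::] (pres_eq_inv_word R v).
  rewrite !cats0 /= -!catA => e2 e3.
  exact: pres_trans (pres_sym e2) e3.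
elim=> {u v} // [u v w _ -> _ -> //|u v b x|u v r Rr].
  by rewrite !eval_cat !eval_cons eval_nil; case: b; rewrite /= mulg1 ?mulVg ?mulgV mul1g.
suff /gR e : pres_eq R r [::] by rewrite !eval_cat e mul1g.
by have := pres_relator [::] [::] Rr; rewrite cats0.
Qed.

Definition pmap_word (X Y : Type) (f : X -> option Y) (w : word X) : word Y :=
  pmap (fun l => omap (pair l.1) (f l.2)) w.

Lemma pmap_word_cat (X Y : Type) (f : X -> option Y) u v :
  pmap_word f (u ++ v) = pmap_word f u ++ pmap_word f v.
Proof. exact: pmap_cat. Qed.

Lemma pmap_word_some (X Y : Type) (h : X -> Y) w :
  pmap_word (Some \o h) w = [seq (l.1, h l.2) | l <- w].
Proof. by elim: w => //= l w ->. Qed.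

(* Letters outside the domain of f are erased: this covers both injections of
   alphabets and the retractions onto special subgroups. *)
Lemma pres_eq_pmap (X Y : Type) (E : X -> X -> Prop) (F : Y -> Y -> Prop)
    (f : X -> option Y) u v :
  (forall x y x' y', f x = Some x' -> f y = Some y' -> x <> y -> E x y ->
     x' <> y' /\ F x' y') ->
  pres_eq (ra_relator E) u v ->
  pres_eq (ra_relator F) (pmap_word f u) (pmap_word f v).
Proof.
move=> fE; elim=> {u v} [w|u v _ IH|u v w _ IHu _ IHv|u v b x|u v r Rr].
- exact: pres_refl.
- exact: pres_sym.
- exact: pres_trans IHu IHv.
- rewrite !pmap_word_cat /=; case: (f x) => [y|] /=; last exact: pres_refl.
  exact: (pres_cancel _ _ _ b).
rewrite !pmap_word_cat; case: Rr => [x|x y xy Exy]; rewrite /pmap_word /=.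
  case: (f x) => [x'|] /=; last exact: pres_refl.
  exact: (pres_relator _ _ (ra_square F _)).
(* A commutation relator with one letter erased is the square of the other letter. *)
case fx: (f x) => [x'|]; case fy: (f y) => [y'|] /=; last exact: pres_refl.
- by have [x'y' Fxy] := fE _ _ _ _ fx fy xy Exy; exact: (pres_relator _ _ (ra_commute x'y' Fxy)).
- exact: (pres_relator _ _ (ra_square F _)).
- exact: (pres_relator _ _ (ra_square F _)).
Qed.

(** Special subgroups inherit the presentation: erasing the letters outside the image of [h] is a
    retraction, so a derivation over [X] projects to one over [Y]. *)
Lemma presents_sub (G : groupType) (A : set G) (X Y : Type) (g : X -> G)
    (E : X -> X -> Prop) (h : Y -> X) :
  presents A g (ra_relator E) -> injective h ->
  presents (range (eval_word (g \o h))) (g \o h)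
           (ra_relator (fun y z => E (h y) (h z))).
Proof.
move=> [rg gR] h_inj; split=> // w; rewrite -eval_map gR.
have [f fh hf] : exists2 f : X -> option Y, forall y, f (h y) = Some y
    & forall x y, f x = Some y -> h y = x.
  have ex x : exists o : option Y, if o is Some y then h y = x
                                   else forall y, h y <> x.
    have [[y <-]|no] := pselect (exists y, h y = x); first by exists (Some y).
    by exists None => y e; apply: no; exists y.
  have [f fP] := choice ex; exists f => [y|x y e].
    by have := fP (h y); case: (f _) => [z /h_inj-> //|/(_ y)].
  by have := fP x; rewrite e.
split=> [e|].
  have -> : w = pmap_word f [seq (l.1, h l.2) | l <- w].
    by rewrite /pmap_word; elim: w {e} => //= -[b y] w <-; rewrite fh.
  apply: (pres_eq_pmap (v := [::])) e => x y x' y' /hf <- /hf <- xy Exy.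
  by split=> // e; apply: xy; rewrite e.
move=> e; rewrite -pmap_word_some -[[::]]/(pmap_word (Some \o h) [::]).
apply: pres_eq_pmap e => x y _ _ [<-] [<-] xy Exy.
by split=> // /h_inj.
Qed.

(** Every relator contains each letter an even number of times, so counting [x] modulo 2 is a
    homomorphism onto the group of order two. *)
Lemma pres_eq_parity (X : Type) (E : X -> X -> Prop) (x : X) u v :
  pres_eq (ra_relator E) u v ->
  odd (count (fun l => `[< l.2 = x >]) u) = odd (count (fun l => `[< l.2 = x >]) v).
Proof.
elim=> {u v} // [u v w _ -> _ -> //|u v b y|u v r Rr].
  by rewrite !count_cat !oddD /=; case: `[< _ >].
rewrite !count_cat !oddD; case: Rr => [y|y z _ _] /=.
  by rewrite !oddD; case: `[< _ >].
by rewrite !oddD; case: `[< _ >]; case: `[< _ >].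
Qed.

(** A word for [b] contributes the same parity of letters [x] to both sides, so [y] must contribute
    as much as [x]. *)
Lemma presents_conj (G : groupType) (A : set G) (X : Type) (g : X -> G) E b x y :
  presents A g (ra_relator E) -> A b -> b * g x = g y * b -> x = y.
Proof.
move=> gP; have [rg _] := gP; rewrite -rg => -[w _ <-] e.
have /(presents_eval _ _ gP)/(pres_eq_parity x) :
    eval_word g (w ++ [:: (false, x)]) = eval_word g ([:: (false, y)] ++ w).
  by rewrite !eval_cat !eval_cons eval_nil !mulg1.
rewrite !count_cat !oddD /=; case: (asboolP (x = x)) => // _.
by case: (asboolP (y = x)) => [//|_]; case: (odd _).
Qed.

Lemma presents_closed (G : groupType) (A : set G) (X : Type) (g : X -> G) R :
  presents A g R -> group_closed (mem A).
Proof.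
move=> [<- _]; split=> [|_ _ /set_mem[u _ <-] /set_mem[v _ <-]]; apply: mem_set.
  by exists [::]; rewrite ?eval_nil.
by exists (u ++ inv_word v); rewrite ?eval_cat ?eval_inv_word.
Qed.

Lemma presents_gen (G : groupType) (A : set G) (X : Type) (g : X -> G) R x :
  presents A g R -> A (g x).
Proof.
by move=> [<- _]; exists [:: (false, x)]; rewrite // eval_cons eval_nil mulg1.
Qed.

(** * Coxeter bases *)

(** A basis is indexed by its own elements, so the presentation is reindexed along a section [h] of
    [g], to which [presents_sub] applies. *)
Lemma coxeter_basis_range (G : groupType) (A : set G) (X : Type) (g : X -> G) E :
  presents A g (ra_relator E) -> coxeter_basis A (range g).
Proof.
move=> gP; have [rg _] := gP.
have /choice[h hP] (s : range g) : exists x, g x = val s.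
  by have [x _ e] := set_valP s; exists x.
have hE : g \o h = val by apply/funext.
have h_inj : injective h by move=> s t e; apply: val_inj; rewrite -!hP e.
have := presents_sub gP h_inj; rewrite hE => sP.
exists (fun s t => E (h s) (h t)); suff <- : range (eval_word (val : range g -> G)) = A.
  by [].
rewrite -rg; apply/seteqP; split=> _ [w _ <-].
  by exists [seq (l.1, h l.2) | l <- w]; rewrite // eval_map hE.
have gx x : g x \in range g by apply: mem_set; exists x.
pose k x : range g := exist _ (g x) (gx x).
by exists [seq (l.1, k l.2) | l <- w]; rewrite // eval_map.
Qed.

Definition gen_subgroup (G : groupType) (S : set G) : set G :=
  range (eval_word (val : S -> G)).

Lemma gen_subgroupS (G : groupType) (S U : set G) :
  S `<=` U -> gen_subgroup S `<=` gen_subgroup U.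
Proof.
move=> sSU _ [w _ <-]; have sU (s : S) : val s \in U.
  exact/mem_set/sSU/set_valP.
pose h (s : S) : U := exist _ (val s) (sU s).
by exists [seq (l.1, h l.2) | l <- w]; rewrite // eval_map.
Qed.

Lemma coxeter_basis_gen (G : groupType) (A S : set G) :
  coxeter_basis A S -> gen_subgroup S = A.
Proof. by move=> [E []]. Qed.

Lemma coxeter_basis_sub (G : groupType) (A S : set G) :
  coxeter_basis A S -> S `<=` A.
Proof.
by move=> [E SP] s Ss; have := presents_gen (exist _ s (mem_set Ss) : S) SP.
Qed.

Lemma coxeter_basis_closed (G : groupType) (A S : set G) :
  coxeter_basis A S -> group_closed (mem A).
Proof. by move=> [E /presents_closed]. Qed.

Lemma coxeter_basis_special (G : groupType) (B S T : set G) :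
  coxeter_basis B T -> S `<=` T -> coxeter_basis (gen_subgroup S) S.
Proof.
move=> [E TP] sST; have sT (s : S) : val s \in T by exact/mem_set/sST/set_valP.
pose h (s : S) : T := exist _ (val s) (sT s).
have h_inj : injective h by move=> s t [e]; exact: val_inj.
by exists (fun s t => E (h s) (h t)); exact: (presents_sub TP h_inj).
Qed.

Lemma closed1 (G : groupType) (A : set G) : group_closed (mem A) -> A 1.
Proof. by move=> [/set_mem]. Qed.

Lemma closedV (G : groupType) (A : set G) x :
  group_closed (mem A) -> A x -> A x^-1.
Proof. by move=> cA /mem_set/(group_closedV cA)/set_mem. Qed.

Lemma closedM (G : groupType) (A : set G) x y :
  group_closed (mem A) -> A x -> A y -> A (x * y).
Proof. by move=> cA /mem_set Ax /mem_set /(group_closedM cA Ax)/set_mem. Qed.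

Lemma closed_eval (G : groupType) (A : set G) (X : Type) (g : X -> G) w :
  group_closed (mem A) -> (forall x, A (g x)) -> A (eval_word g w).
Proof.
move=> cA Ag; elim: w => [|l w IH]; first by rewrite eval_nil; exact: closed1.
rewrite eval_cons; apply: closedM => //.
by case: l.1 => //; exact: closedV.
Qed.

(** A subset of a basis is a basis of the subgroup it generates, which reduces [prec] to a statement
    about generation. *)
Lemma prec_gen (G : groupType) (A B T : set G) :
  coxeter_basis B T -> group_closed (mem A) -> A `<=` B ->
  A `<=` gen_subgroup (A `&` T) -> prec A B.
Proof.
move=> bT cA sAB sAg; split; first by split=> //; exact: coxeter_basis_closed bT.
exists T; split=> //; have := coxeter_basis_special bT (@subIsetr _ A T).
suff <- : A = gen_subgroup (A `&` T) by [].
apply/seteqP; split=> // _ [w _ <-]; apply: closed_eval => // s.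
by have [] := set_valP s.
Qed.

Lemma prec_refl (G : groupType) (A S : set G) : coxeter_basis A S -> prec A A.
Proof.
move=> bS; apply: (prec_gen bS) => //; first exact: coxeter_basis_closed bS.
rewrite -{1}(coxeter_basis_gen bS); apply: gen_subgroupS => s Ss; split=> //.
exact: coxeter_basis_sub bS _ Ss.
Qed.

(** * Transport of bases *)

Lemma morph_in1 (G H : groupType) (A : set G) (f : G -> H) :
  group_closed (mem A) -> {in A &, {morph f : x y / x * y}} -> f 1 = 1.
Proof.
move=> cA fM; have A1 := mem_set (closed1 cA).
by apply: (mulgI (f 1)); rewrite -fM // !mulg1.
Qed.

Lemma morph_inV (G H : groupType) (A : set G) (f : G -> H) x :
  group_closed (mem A) -> {in A &, {morph f : x y / x * y}} -> A x ->
  f x^-1 = (f x)^-1.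
Proof.
move=> cA fM Ax; apply: (mulgI (f x)).
by rewrite -fM ?mulgV ?(morph_in1 cA fM) //; apply: mem_set => //; exact: closedV.
Qed.

Lemma eval_morph (G H : groupType) (A : set G) (f : G -> H) (X : Type)
    (g : X -> G) w :
  group_closed (mem A) -> {in A &, {morph f : x y / x * y}} ->
  (forall x, A (g x)) -> eval_word (f \o g) w = f (eval_word g w).
Proof.
move=> cA fM Ag; elim: w => [|[b x] w IH].
  by rewrite !eval_nil (morph_in1 cA fM).
have Ax : A (if b then (g x)^-1 else g x) by case: b => //; exact: closedV.
rewrite !eval_cons IH /= fM; try exact: mem_set.
  by case: b {Ax} => //; rewrite (morph_inV cA fM).
by apply: mem_set; exact: closed_eval.
Qed.

Lemma presents_morph (G H : groupType) (A : set G) (f : G -> H) (X : Type)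
    (g : X -> G) R :
  group_closed (mem A) -> {in A &, {morph f : x y / x * y}} ->
  {in A &, injective f} -> (forall x, A (g x)) ->
  presents A g R <-> presents (f @` A) (f \o g) R.
Proof.
move=> cA fM f_inj Ag; have fE w := eval_morph w cA fM Ag.
have Aw w : A (eval_word g w) by exact: closed_eval.
have f1 w : eval_word (f \o g) w = 1 <-> eval_word g w = 1.
  rewrite fE -(morph_in1 cA fM); split=> [|->//].
  by apply: f_inj; apply: mem_set => //; exact: closed1.
split=> -[rg gR]; split.
- rewrite -rg; apply/seteqP; split=> [_ [w _ <-]|_ [_ [w _ <-] <-]].
    by exists (eval_word g w).
  by exists w.
- by move=> w; rewrite f1.
- apply/seteqP; split=> [_ [w _ <-] //|a Aa].
  have : (f @` A) (f a) by exists a.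
  rewrite -rg => -[w _]; rewrite fE => e; exists w => //.
  by apply: f_inj e; exact: mem_set.
- by move=> w; rewrite -f1.
Qed.

Lemma coxeter_basis_conj (G : groupType) (B T : set G) b :
  coxeter_basis B T -> B b -> coxeter_basis B [set b * s * b^-1 | s in T].
Proof.
move=> bT Bb; have cB := coxeter_basis_closed bT; have [E TP] := bT.
pose f x := b * x * b^-1; have BVb := closedV cB Bb.
have fM : {in B &, {morph f : x y / x * y}}.
  by move=> x y _ _; rewrite /f !mulgA mulgVK.
have f_inj : {in B &, injective f} by move=> x y _ _ /mulIg /mulgI.
have fB : f @` B = B.
  apply/seteqP; split=> [_ [x Bx <-]|x Bx]; first by do 2!apply: closedM => //.
  exists (b^-1 * x * b); first by do 2!apply: closedM => //.
  by rewrite /f -!mulgA mulgV mulg1 mulVKg.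
have Bs (s : T) : B (val s) by exact/(coxeter_basis_sub bT)/set_valP.
have /(presents_morph _ cB fM f_inj Bs) := TP; rewrite fB.
move=> /coxeter_basis_range; congr coxeter_basis.
apply/seteqP; split=> _ [s Ts <-]; first by exists (val s) => //; exact: set_valP.
by exists (exist _ s (mem_set Ts) : T).
Qed.

(** The part of a basis of [B] inside the image of [f] pulls back to a basis of [A]. Rigidity of [A]
    conjugates [S] to it, and the conjugation is undone in [B]. *)
Lemma prec_embedding_basis (G H : groupType) (A S : set G) (B : set H) f :
  strongly_rigid A -> coxeter_basis A S -> prec_embedding A B f ->
  exists2 T, coxeter_basis B T & f @` S `<=` T.
Proof.
move=> rA bS [fM f_inj [[_ cB fAB] [T [bT [E TP]]]]].
have cA := coxeter_basis_closed bS.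
have /choice[g gP] (t : f @` A `&` T) : exists a, A a /\ f a = val t.
  by have [[a Aa <-] _] := set_valP t; exists a.
have gE : f \o g = val by apply/funext => t; case: (gP t).
have Ag t : A (g t) by case: (gP t).
have /coxeter_basis_range bg : presents A g (ra_relator E).
  by apply/(presents_morph _ cA fM f_inj Ag); rewrite gE.
(* As [a] conjugates [S] onto the pulled-back basis, conjugating by the inverse of [f a] brings [T]
   to a basis containing the image of [S]. *)
have [a Aa aS] := rA _ _ bS bg; pose b := (f a)^-1.
have Bb : B b by apply: closedV => //; apply: fAB; exists a.
exists [set b * s * b^-1 | s in T]; first exact: coxeter_basis_conj.
move=> _ [s Ss <-]; have [t _ tE] : range g (a * s * a^-1) by rewrite -aS; exists s.
have As := coxeter_basis_sub bS Ss; have AVa := closedV cA Aa.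
exists (val t); first by have [] := set_valP t.
rewrite -(proj2 (gP t)) tE fM ?(morph_inV cA fM) //; try exact: mem_set.
  by rewrite fM /b ?invgK; [rewrite -!mulgA mulVg mulg1 mulKg|exact: mem_set..].
by apply: mem_set; exact: closedM.
Qed.

Lemma prec_basis (G : groupType) (A B S : set G) :
  strongly_rigid A -> coxeter_basis A S -> prec A B ->
  exists2 T, coxeter_basis B T & S `<=` T.
Proof.
move=> rA bS pAB; rewrite -(image_id S).
by apply: prec_embedding_basis rA bS _; split; rewrite ?image_id.
Qed.

(** * Centralizers of generators *)

Lemma presents_square (G : groupType) (A : set G) (X : Type) (g : X -> G) E x :
  presents A g (ra_relator E) -> (g x)^-1 = g x.
Proof.
move=> gP; apply: mulg1_eq.
have /(presents_eval _ _ gP) := pres_relator [::] [::] (ra_square E x).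
by rewrite /= !eval_cons eval_nil mulg1.
Qed.

Lemma presents_commute (G : groupType) (A : set G) (X : Type) (g : X -> G) E x y :
  presents A g (ra_relator E) -> x <> y -> E x y -> commute (g x) (g y).
Proof.
move=> gP xy Exy.
have /(presents_eval _ _ gP) := pres_relator [::] [::] (ra_commute xy Exy).
rewrite /= !eval_cons eval_nil mulg1 /= mulgA => /mulg1_eq.
by rewrite invgM !(presents_square _ gP).
Qed.

Lemma presents_eval_cons (G : groupType) (A : set G) (X : Type) (g : X -> G) E l w :
  presents A g (ra_relator E) -> eval_word g (l :: w) = g l.2 * eval_word g w.
Proof. by move=> gP; rewrite eval_cons (presents_square _ gP) if_same. Qed.

(** Adjacency is read off from commutation in [G], which is reflexive and symmetric, so the star
    contains [x]; the relation [E] may be neither. *)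
Definition star_subgroup (G : groupType) (X : Type) (g : X -> G) (x : X) : set G :=
  [set eval_word g w | w in
    [set w | all (fun l => `[< commute (g x) (g l.2) >]) w]].

(* The parity of the number of times the path spelled by w crosses the wall
   of x: suffixes are tested for membership in the stabilizer of that wall. *)
Fixpoint wall_parity (G : groupType) (X : Type) (g : X -> G) (x : X)
    (w : word X) : bool :=
  if w is l :: w' then
    (`[< l.2 = x >] && `[< star_subgroup g x (eval_word g w') >])
      (+) wall_parity g x w'
  else false.

Lemma star_subgroupMl (G : groupType) (A : set G) (X : Type) (g : X -> G) E x y k :
  presents A g (ra_relator E) -> commute (g x) (g y) ->
  `[< star_subgroup g x (g y * k) >] = `[< star_subgroup g x k >].
Proof.
move=> gP cxy; apply: asbool_equiv_eq.
have H k' : star_subgroup g x k' -> star_subgroup g x (g y * k').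
  move=> [w ws <-]; exists ((false, y) :: w); last by rewrite eval_cons.
  by rewrite /= ws andbT; apply/asboolP.
split=> [/H|/H //]; rewrite mulgA -{1}(presents_square y gP) mulVg mul1g //.
Qed.

Lemma star_subgroupMr (G : groupType) (A : set G) (X : Type) (g : X -> G) E x k :
  presents A g (ra_relator E) ->
  `[< star_subgroup g x (k * g x) >] = `[< star_subgroup g x k >].
Proof.
move=> gP; apply: asbool_equiv_eq.
have H k' : star_subgroup g x k' -> star_subgroup g x (k' * g x).
  move=> [w ws <-]; exists (w ++ [:: (false, x)]).
    by rewrite /= all_cat ws /= andbT; apply/asboolP.
  by rewrite eval_cat eval_cons eval_nil mulg1.
by split=> [/H|/H //]; rewrite -mulgA -{1}(presents_square x gP) mulVg mulg1.
Qed.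

Lemma wall_parity_cat (G : groupType) (X : Type) (g : X -> G) x u v v' :
  eval_word g v = eval_word g v' -> wall_parity g x v = wall_parity g x v' ->
  wall_parity g x (u ++ v) = wall_parity g x (u ++ v').
Proof. by move=> ev wv; elim: u => //= l u ->; rewrite !eval_cat ev. Qed.

(** A prefix sees only the value of what follows it. Inside a relator or a cancelling pair, [x]
    occurs twice or never, and the suffixes after its two occurrences differ by left factors from
    the star, so the two contributions cancel. *)
Lemma wall_parity_pres_eq (G : groupType) (A : set G) (X : Type) (g : X -> G) E x u v :
  presents A g (ra_relator E) -> pres_eq (ra_relator E) u v ->
  wall_parity g x u = wall_parity g x v.
Proof.
move=> gP; elim=> {u v} // [u v w _ -> _ -> //|u v b y|u v r Rr];
    apply: wall_parity_cat.
- exact/(presents_eval _ _ gP)/(pres_cancel _ [::]).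
- rewrite /= (presents_eval_cons _ _ gP) /=.
  case: (asboolP (y = x)) => [->|_] //=.
  by rewrite (star_subgroupMl _ gP) // addbA addbb.
- exact/(presents_eval _ _ gP)/(pres_relator [::]).
case: Rr => [y|y z yz Eyz] /=; rewrite !(presents_eval_cons _ _ gP) /=.
  case: (asboolP (y = x)) => [->|_] //=.
  by rewrite (star_subgroupMl _ gP) // addbA addbb.
have cyz := presents_commute gP yz Eyz.
case: (asboolP (y = x)) => [yx|_]; case: (asboolP (z = x)) => [zx|_] //=.
- by case: yz; rewrite yx zx.
- rewrite yx in cyz *; rewrite !(star_subgroupMl _ gP) //.
  by rewrite addbA addbb.
rewrite zx in cyz *; have cxy := commute_sym cyz; rewrite !(star_subgroupMl _ gP) //.
by rewrite addbA addbb.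
Qed.

(* Write c for wall_parity.  Then c (b x) = c b + 1 always, whereas
   c (x b) = c b + 1 only if b lies in the star subgroup. *)
Lemma presents_centralizer (G : groupType) (A : set G) (X : Type) (g : X -> G) E x b :
  presents A g (ra_relator E) -> A b -> commute b (g x) -> star_subgroup g x b.
Proof.
move=> gP; have [rg _] := gP; rewrite -rg => -[w _ <-] cwx.
have /(presents_eval _ _ gP)/(wall_parity_pres_eq x gP) :
    eval_word g (w ++ [:: (false, x)]) = eval_word g ((false, x) :: w).
  by rewrite eval_cat !eval_cons eval_nil mulg1.
(* The appended letter multiplies each earlier suffix by [g x], which leaves its test unchanged, and
   itself counts once, its suffix being empty. *)
have -> : wall_parity g x (w ++ [:: (false, x)]) = ~~ wall_parity g x w.
  elim: w {cwx} => [|l w IH] /=.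
    rewrite addbF; apply/andP; split; apply/asboolP => //.
    by exists [::].
  rewrite IH eval_cat eval_cons eval_nil mulg1 /= (star_subgroupMr _ _ gP).
  by rewrite addbN.
(* The prepended letter counts only if the value of [w] is in the star subgroup; otherwise a parity
   would equal its negation. *)
rewrite /=; case: (asboolP (x = x)) => //= _.
by case: asboolP => // _; case: wall_parity.
Qed.

(** The retraction onto the special subgroup on [P] fixes the word [u] and filters [v]. *)
Lemma eval_filter (G : groupType) (A : set G) (X : Type) (g : X -> G) E
    (P : pred X) u v :
  presents A g (ra_relator E) -> all (fun l => P l.2) u ->
  eval_word g u = eval_word g v ->
  eval_word g [seq l <- v | P l.2] = eval_word g u.
Proof.
move=> gP Pu /(presents_eval _ _ gP) uv; apply/(presents_eval _ _ gP).
pose f x := if P x then Some x else None.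
have fE w : pmap_word f w = [seq l <- w | P l.2].
  by elim: w => //= -[b x] w <-; rewrite /pmap_word /= /f; case: (P x).
apply: pres_sym; rewrite -[u in pres_eq _ u](all_filterP Pu) -!fE.
apply: pres_eq_pmap uv => x y x' y'.
by rewrite /f; case: (P x) => // -[<-]; case: (P y) => // -[<-].
Qed.

(** Two special subgroups intersect in the special subgroup on the common generators: a word over
    the star of [x] is retracted to [P]. This allows centralizers to be intersected one by one. *)
Lemma star_subgroup_filter (G : groupType) (A : set G) (X : Type) (g : X -> G) E
    (P : pred X) x w :
  presents A g (ra_relator E) -> all (fun l => P l.2) w ->
  commute (eval_word g w) (g x) ->
  exists2 w', eval_word g w' = eval_word g w
    & all (fun l => P l.2 && `[< commute (g x) (g l.2) >]) w'.
Proof.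
move=> gP Pw cwx; have [rg _] := gP.
have [|v vx ev] := presents_centralizer gP _ cwx; first by rewrite -rg; exists w.
exists [seq l <- v | P l.2]; first exact: (eval_filter gP Pw).
by rewrite all_filter; apply: sub_all vx => l /= ->; rewrite andbT implybb.
Qed.

(** * Four-paths and the uniqueness of bases *)

Lemma four_path_centralizer (G : groupType) (B P T : set G) b :
  coxeter_basis B T -> triangle_free T -> has_four_path P -> P `<=` T ->
  B b -> (forall s, P s -> commute b s) -> b = 1.
Proof.
move=> [E gP] tfT [s0 [s1 [s2 [s3 [[P0 P1 P2 P3] u4 [a01 a12 a23] n02 n13]]]]] PT Bb cP.
have [rg _] := gP; move: Bb cP; rewrite -rg => -[w _ <-] cP {b}.
pose el s (Ps : P s) : T := exist _ s (mem_set (PT _ Ps)).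
pose adj s y := `[< commute s (val (y : T)) >].
(* Each use shrinks the alphabet of a word for [b] to the star of one more vertex of the path. *)
have step (Q : pred T) s v : P s -> eval_word val v = eval_word val w ->
    all (fun l => Q l.2) v ->
    exists2 v', eval_word val v' = eval_word val w
      & all (fun l => Q l.2 && adj s l.2) v'.
  move=> Ps ev Qv; rewrite -ev.
  apply: (star_subgroup_filter (x := el _ Ps) gP Qv).
  by rewrite ev; exact: cP.
have [v0 e0 h0] := step predT _ _ P0 erefl (all_predT w).
have [v1 e1 h1] := step (fun y => predT y && adj s0 y) _ _ P1 e0 h0.
have [v2 e2 h2] := step (fun y => predT y && adj s0 y && adj s1 y) _ _ P2 e1 h1.
have [v3 <- h3] :=
  step (fun y => predT y && adj s0 y && adj s1 y && adj s2 y) _ _ P3 e2 h2.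
case: v3 h3 => [|[c y] v3] /=; first by rewrite eval_nil.
case/andP => /andP[/andP[/andP[/asboolP c0 /asboolP c1]]] /asboolP c2 /asboolP c3 _.
move: u4; rewrite /= !inE !negb_or => /andP[/and3P[/eqP d01 /eqP d02 _]].
move=> /andP[/andP[_ /eqP d13] _]; exfalso.
(* A remaining letter [y] commutes with all four vertices: if it is [s0] or [s1], this creates a
   forbidden chord of the path, and otherwise a triangle with [s0] and [s1]. *)
have [y0|y0] := pselect (s0 = val y).
  by apply: n02; split=> //; rewrite y0; exact: commute_sym.
have [y1|y1] := pselect (s1 = val y).
  by apply: n13; split=> //; rewrite y1; exact: commute_sym.
by apply: (tfT s0 s1 (val y)); [exact: (PT _ P0)|exact: (PT _ P1)|exact: set_valP|split].
Qed.

Lemma four_path_basis_unique (G : groupType) (B P T T' : set G) :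
  strongly_rigid B -> coxeter_basis B T -> coxeter_basis B T' ->
  triangle_free T -> has_four_path P -> P `<=` T -> P `<=` T' -> T' = T.
Proof.
move=> rB bT bT' tfT hP PT PT'; have [b Bb bTE] := rB _ _ bT bT'.
suff b1 : b = 1.
  rewrite -bTE b1; apply/seteqP; split=> [_ [s Ts <-]|s Ts].
    by rewrite mul1g invg1 mulg1.
  by exists s; rewrite // mul1g invg1 mulg1.
apply: (four_path_centralizer bT tfT hP PT Bb) => s Ps.
have [E gP] := bT; have : T' s by exact: PT'.
(* Here [s] is the conjugate by [b] of some [t] in [T]; both lie in [T], so they coincide and [b]
   centralizes [s]. *)
rewrite -bTE => -[t Tt e].
pose x : T := exist _ t (mem_set Tt); pose y : T := exist _ s (mem_set (PT _ Ps)).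
have bts : b * t = s * b by rewrite -e mulgVK.
have [ts] : x = y by exact: (presents_conj gP Bb).
by rewrite /commute -{1}ts.
Qed.

(** * Smoothness and finite character *)

Theorem theorem5p4 (K : group_class)
  (K_racg : forall (G : groupType) (A : set G), K G A ->
     ra_coxeter_group A /\ strongly_rigid A)
  (K_triangle_free : forall (G : groupType) (A S : set G), K G A ->
     coxeter_basis A S -> triangle_free S)
  (K_four_path : forall (G : groupType) (A B T : set G), K G A -> K G B ->
     prec A B -> coxeter_basis B T -> coxeter_basis A (T `&` A) ->
     has_four_path (T `&` A)) :
  (forall (G : groupType) (d : Order.disp_t) (I : orderType d)
     (A : I -> set G) (B : set G),
     nonzero_ordinal I ->
     (forall i : I, K G (A i)) ->
     increasing_chain A -> continuous_chain A ->
     K G B -> (forall i : I, prec (A i) B) ->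
     prec (\bigcup_(i : I) A i) B) /\
  (forall (G : groupType) (A B : set G), K G A -> K G B ->
     is_subgroup A B ->
     (forall X : set G, finite_set X -> X `<=` A ->
        exists2 f : G -> G, prec_embedding A B f & {in X, f =1 id}) ->
     prec A B).
Proof.
(* The four-path hypothesis is applied to the pair formed by [A] and itself. *)
have four (G : groupType) (A S : set G) : K G A -> coxeter_basis A S ->
    has_four_path S.
  move=> KA bS; have AS : S `&` A = S.
    by apply/setIidPl; exact: coxeter_basis_sub bS.
  have := K_four_path G A A S KA KA (prec_refl bS) bS.
  by rewrite AS; exact.
split=> [G d I A B [[i0] _] KA incA _ KB pAB|G A B KA KB [cA cB sAB] emb].
  have [[_ [S0 bS0]] r0] := K_racg _ _ (KA i0).
  have h4 := four _ _ _ (KA i0) bS0; have [_ rB] := K_racg _ _ KB.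
  (* The basis [S0] of one member of the chain contains a four-path, and so singles out [T] among
     the bases of [B]. *)
  have [T bT S0T] := prec_basis r0 bS0 (pAB i0).
  have tfT := K_triangle_free _ _ _ KB bT.
  have mono i j : (i <= j)%O -> A i `<=` A j.
    by rewrite le_eqVlt => /predU1P[-> //|/incA[[]]].
  (* From [i0] on, [S0] extends to a basis of [A i] and then to a basis of [B], which can only be
     [T]. *)
  have genT i : (i0 <= i)%O -> A i `<=` gen_subgroup (A i `&` T).
    move=> le0i; have [S bS S0S] : exists2 S, coxeter_basis (A i) S & S0 `<=` S.
      move: le0i; rewrite le_eqVlt => /predU1P[<-|/incA]; first by exists S0.
      exact: prec_basis.
    have [T' bT' ST'] := prec_basis (proj2 (K_racg _ _ (KA i))) bS (pAB i).
    have TT' : T' = T.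
      by apply: (four_path_basis_unique rB bT bT' tfT h4 S0T) => s /S0S /ST'.
    rewrite -{1}(coxeter_basis_gen bS); apply: gen_subgroupS => s Ss; split.
      exact: coxeter_basis_sub bS _ Ss.
    by rewrite -TT'; exact: ST'.
  apply: (prec_gen bT) => [|a [i _ Aa]|a [i _ Aa]].
  - split=> [|x y /set_mem[i _ Ax] /set_mem[j _ Ay]].
      by apply: mem_set; exists i0 => //; exact: closed1 (coxeter_basis_closed bS0).
    apply: mem_set; pose m := Order.max i j; exists m => //.
    have [cm _] := proj1 (K_racg _ _ (KA m)).
    have Amx : A m x by apply: mono Ax; rewrite le_max lexx.
    have Amy : A m y by apply: mono Ay; rewrite le_max lexx orbT.
    by apply: closedM => //; exact: closedV.
  - by have [[_ _ sAB] _] := pAB i; exact: sAB.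
  (* Indices below [i0] are absorbed by passing to the maximum. *)
  have le0 : (i0 <= Order.max i0 i)%O by rewrite le_max lexx.
  have Am : A (Order.max i0 i) a by apply: mono Aa; rewrite le_max lexx orbT.
  apply: gen_subgroupS (genT _ le0 _ Am) => s [As Ts]; split=> //.
  by exists (Order.max i0 i).
have [[_ [S bS]] rA] := K_racg _ _ KA; have [_ rB] := K_racg _ _ KB.
have h4 := four _ _ _ KA bS.
(* The basis [S] may be infinite, so the path is cut down to its four vertices, which an embedding
   can be asked to fix. *)
have [s0 [s1 [s2 [s3 [[S0 S1 S2 S3] u4 a4 n02 n13]]]]] := h4.
pose P : set G := [set s0; s1; s2; s3].
have hP : has_four_path P.
  exists s0, s1, s2, s3; split=> //; split; rewrite /P /=; tauto.
have PS : P `<=` S by move=> s /= [[[]|]|] ->.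
have finP : finite_set P.
  by rewrite /P !finite_setU; do !split; exact: finite_set1.
(* An embedding fixing [P] and [s] sends [S] into a basis of [B], which then contains these fixed
   points. *)
have ext s : S s -> exists2 T, coxeter_basis B T & P `<=` T /\ T s.
  move=> Ss; have [||f fE fid] := emb (P `|` [set s]).
  - by rewrite finite_setU; split=> //; exact: finite_set1.
  - by move=> x [Px|->]; apply: (coxeter_basis_sub bS) => //; exact: PS.
  have [T bT fST] := prec_embedding_basis rA bS fE; exists T => //.
  have fT x : S x -> (P `|` [set s]) x -> T x.
    by move=> Sx Px; rewrite -[x]fid; [apply: fST; exists x|exact: mem_set].
  by split=> [x Px|]; apply: fT => //; [exact: PS|left|right].
(* The bases found for different [s] all contain [P], hence equal this [T], which therefore contains
   all of [S]. *)
have [T bT [PT _]] := ext _ S0; have tfT := K_triangle_free _ _ _ KB bT.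
apply: (prec_gen bT cA sAB); rewrite -{1}(coxeter_basis_gen bS).
apply: gen_subgroupS => s Ss; split; first exact: coxeter_basis_sub bS _ Ss.
have [T' bT' [PT' T's]] := ext _ Ss.
by rewrite -(four_path_basis_unique rB bT bT' tfT hP PT PT').
Qed.
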